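(* Let $S$ be a Morse set and let $F_S$ be the persistent vector space (over a field $\Bbbk$) freely generated by $S$. Let $E$ be the barcode associated to $S$ by the Elder Rule and let $V_E=\bigoplus_{I\in E} I_{\Bbbk}$ (with multiplicity) be the persistent vector space associated to $E$. Then $F_S\cong V_E$ as persistent vector spaces.
   Context: $\Bbbk$ is an arbitrary field. A persistent set (resp. persistent vector space) is a functor from the poset $(\mathbb{R},\le)$ to sets (resp. $\Bbbk$-vector spaces); its structure maps $\varphi_{tr}$ for $r\le t$ are called shift maps; isomorphism means natural isomorphism. For a persistent set $S$, $F_S(t)$ is the vector space with basis $S(t)$, with shift maps the linear extensions of those of $S$. For an interval $I\subseteq\mathbb{R}$, the interval module $I_{\Bbbk}$ is $\Bbbk$ at $t\in I$ and $0$ at $t\notin I$, with identity shift maps between points of $I$ and zero shift maps otherwise. **Morse sets.** A Morse set is a functor $S:(\mathbb{R},\le)\to$ finite sets, together with a finite minimal set of times $\tau_1<\dots<\tau_n$ such that: (1) $S(t)=\varnothing$ for $t<\tau_1$; (2) $S|_{[\tau_i,\tau_{i+1})}$ is naturally isomorphic to the constant functor with value $S(\tau_i)$ for $1\le i\le n-1$; (3) $S(t)$ is a one-point set for $t\ge\tau_n$; (4) for every $x\in S(\tau_{i+1})$, the fiber $\varphi_{\tau_{i+1}\tau_i}^{-1}(x)$ has cardinality $0$, $1$ or $2$; (5) each $y\in S(t)$ is contained in a unique oldest maximal chain of the poset $P_S$. Here $P_S=\bigcup_t S(t)\times\{t\}$ with $(x,r)\preceq(y,t)$ iff $r\le t$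 and $\varphi_{tr}(x)=y$, and $\pi:P_S\to\mathbb{R}$ is the projection; a chain $C_1$ is older than a chain $C_2$ if some $t_1\in\pi(C_1)$ satisfies $t_1<t_2$ for all $t_2\in\pi(C_2)$. **Elder Rule.** Let $P_1=P_S$ and let $C_1$ be the oldest maximal chain containing the element of $P_1$ over $\tau_n$. Inductively set $P_{i+1}=P_i\setminus C_i$; if it is nonempty, let $\tau_k$ be the largest of the times $\tau_1,\dots,\tau_n$ over which $P_{i+1}$ has an element, pick an element of $P_{i+1}$ over $\tau_k$, and let $C_{i+1}$ be the oldest maximal chain of $P_{i+1}$ containing it. This ends after finitely many steps and the resulting multiset of intervals $E=\{\pi(C_i)\}$ is the barcode associated to $S$ by the Elder Rule. *)

(* Defs.v *)
From HB Require Import structures.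
From mathcomp Require Import all_boot all_order all_algebra.
From mathcomp Require Import boolp classical_sets reals.

Set Implicit Arguments.
Unset Strict Implicit.
Unset Printing Implicit Defensive.

Import Order.TTheory GRing.Theory Num.Theory.
Local Open Scope classical_set_scope.
Local Open Scope ring_scope.

(* Functors (R, <=) -> finite sets. *)
Record fin_pset (R : realType) := FinPSet {
  ps_obj :> R -> finType;
  ps_map : forall r t : R, r <= t -> ps_obj r -> ps_obj t;
  ps_map_id : forall (t : R) (tt : t <= t) (x : ps_obj t), ps_map tt x = x;
  ps_map_comp : forall (r s t : R) (rs : r <= s) (st : s <= t) (rt : r <= t)
    (x : ps_obj r), ps_map rt x = ps_map st (ps_map rs x)
}.

(* Functors (R, <=) -> K-vector spaces. *)
Record pvect (R : realType) (K : fieldType) := PVect {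
  pv_obj :> R -> lmodType K;
  pv_map : forall r t : R, r <= t -> {linear pv_obj r -> pv_obj t};
  pv_map_id : forall (t : R) (tt : t <= t) (v : pv_obj t), pv_map tt v = v;
  pv_map_comp : forall (r s t : R) (rs : r <= s) (st : s <= t) (rt : r <= t)
    (v : pv_obj r), pv_map rt v = pv_map st (pv_map rs v)
}.

Definition pvect_iso (R : realType) (K : fieldType) (V W : pvect R K) : Prop :=
  exists f : forall t : R, {linear V t -> W t},
    (forall t : R, bijective (f t)) /\
    (forall (r t : R) (rt : r <= t) (v : V r),
       f t (pv_map V rt v) = pv_map W rt (f r v)).

Section FreePVect.
Variable K : fieldType.

Definition free_basis (A : finType) (a : A) : {ffun A -> K^o} :=
  [ffun x => (x == a)%:R].

Definition free_map (A B : finType) (f : A -> B) (v : {ffun A -> K^o}) :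
  {ffun B -> K^o} := \sum_(a : A) v a *: free_basis (f a).

Lemma free_map_is_linear (A B : finType) (f : A -> B) : linear (free_map f).
Proof.
move=> c u v; rewrite /free_map scaler_sumr -big_split /=.
by apply: eq_bigr => a _; rewrite !ffunE scalerDl scalerA.
Qed.

HB.instance Definition _ (A B : finType) (f : A -> B) :=
  GRing.isLinear.Build K {ffun A -> K^o} {ffun B -> K^o} *:%R (free_map f)
    (free_map_is_linear f).

Lemma free_map_basis (A B : finType) (f : A -> B) (a : A) :
  free_map f (free_basis a) = free_basis (f a).
Proof.
rewrite /free_map (bigD1 a) //= ffunE eqxx scale1r big1 ?addr0 // => b /negPf ba.
by rewrite ffunE ba scale0r.
Qed.

Lemma free_basis_sum (A : finType) (v : {ffun A -> K^o}) :
  v = \sum_(a : A) v a *: free_basis a.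
Proof.
apply/ffunP => x; rewrite sum_ffunE (bigD1 x) //= !ffunE eqxx.
rewrite big1 => [|a /negPf ax]; first by rewrite addr0 /GRing.scale /= mulr1.
by rewrite !ffunE eq_sym ax scaler0.
Qed.

Variables (R : realType) (S : fin_pset R).

Lemma free_pvect_id (t : R) (tt : t <= t) (v : {ffun S t -> K^o}) :
  free_map (ps_map tt) v = v.
Proof.
rewrite [RHS]free_basis_sum; apply: eq_bigr => a _.
by rewrite ps_map_id.
Qed.

Lemma free_pvect_comp (r s t : R) (rs : r <= s) (st : s <= t) (rt : r <= t)
  (v : {ffun S r -> K^o}) :
  free_map (ps_map rt) v = free_map (ps_map st) (free_map (ps_map rs) v).
Proof.
rewrite [in RHS]/(free_map (ps_map rs) v) linear_sum; apply: eq_bigr => a _.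
by rewrite linearZ /= free_map_basis (ps_map_comp rs st rt).
Qed.

Definition free_pvect : pvect R K :=
  @PVect R K (fun t => {ffun S t -> K^o})
    (fun r t rt => free_map (ps_map rt)) free_pvect_id free_pvect_comp.

End FreePVect.

Section IntervalModule.
Variables (R : realType) (K : fieldType).

(* [t \in I] coerces to 1 or 0, so 'rV[K]_(t \in I) is K for t in I and 0
   otherwise.  The 1 x 1 matrix [const_mx 1] is the identity; in every other
   case the source or the target is 0. *)
Definition itv_map (I : interval R) (r t : R) :
  {linear 'rV[K]_(r \in I) -> 'rV[K]_(t \in I)} :=
  mulmxr (const_mx 1).

Lemma itv_map_id (I : interval R) (t : R) (tt : t <= t) (v : 'rV[K]_(t \in I)) :
  itv_map I t t v = v.
Proof.
rewrite /itv_map /=; case: (t \in I) v => v; last by rewrite !thinmx0.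
by rewrite (_ : const_mx 1 = 1%:M) ?mulmx1 //; apply/matrixP => i j;
  rewrite !mxE !ord1 eqxx.
Qed.

Lemma itv_map_comp (I : interval R) (r s t : R) (rs : r <= s) (st : s <= t)
  (rt : r <= t) (v : 'rV[K]_(r \in I)) :
  itv_map I r t v = itv_map I s t (itv_map I r s v).
Proof.
rewrite /itv_map /=.
have conv : r \in I -> t \in I -> s \in I.
  case: I {v} => a b; rewrite !itv_boundlr => /andP[ar _] /andP[_ tb].
  by rewrite (le_trans ar) ?(le_trans _ tb) // bnd_simp.
case: (r \in I) v conv => v conv; last by rewrite !thinmx0 !mul0mx.
case: (t \in I) conv => conv; last by rewrite !thinmx0.
rewrite conv // -mulmxA; congr (_ *m _); apply/matrixP => i j.
by rewrite !mxE big_ord1 !mxE mulr1.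
Qed.

Definition itv_pvect (I : interval R) : pvect R K :=
  @PVect R K (fun t => 'rV[K]_(t \in I)) (fun r t _ => itv_map I r t)
    (@itv_map_id I) (@itv_map_comp I).

End IntervalModule.

Section DirectSum.
Variables (R : realType) (K : fieldType).

Definition zero_pvect : pvect R K :=
  @PVect R K (fun _ => 'rV[K]_0) (fun _ _ _ => idfun)
    (fun _ _ _ => erefl) (fun _ _ _ _ _ _ _ => erefl).

Definition pair_map (U U' V V' : lmodType K) (f : {linear U -> U'})
  (g : {linear V -> V'}) (p : U * V) : U' * V' := (f p.1, g p.2).

Lemma pair_map_is_linear (U U' V V' : lmodType K) (f : {linear U -> U'})
  (g : {linear V -> V'}) : linear (pair_map f g).
Proof. by move=> c p q; rewrite /pair_map !linearP. Qed.

HB.instance Definition _ (U U' V V' : lmodType K) (f : {linear U -> U'})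
    (g : {linear V -> V'}) :=
  GRing.isLinear.Build K (U * V)%type (U' * V')%type *:%R (pair_map f g)
    (pair_map_is_linear f g).

Variables V W : pvect R K.

Lemma sum_pvect_id (t : R) (tt : t <= t) (p : V t * W t) :
  pair_map (pv_map V tt) (pv_map W tt) p = p.
Proof. by case: p => v w; rewrite /pair_map /= !pv_map_id. Qed.

Lemma sum_pvect_comp (r s t : R) (rs : r <= s) (st : s <= t) (rt : r <= t)
  (p : V r * W r) :
  pair_map (pv_map V rt) (pv_map W rt) p =
  pair_map (pv_map V st) (pv_map W st) (pair_map (pv_map V rs) (pv_map W rs) p).
Proof.
by rewrite /pair_map /= (pv_map_comp rs st rt) (pv_map_comp rs st rt).
Qed.

Definition sum_pvect : pvect R K :=
  @PVect R K (fun t => (V t * W t)%type)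
    (fun r t rt => pair_map (pv_map V rt) (pv_map W rt))
    sum_pvect_id sum_pvect_comp.

End DirectSum.

(* A multiset of intervals is given by a list. *)
Definition barcode_pvect (R : realType) (K : fieldType) (E : seq (interval R)) :
  pvect R K := foldr (fun I V => sum_pvect (itv_pvect K I) V) (zero_pvect R K) E.

Section Chains.
Variables (R : realType) (S : fin_pset R).

Definition ps_points : Type := {t : R & S t}.

Definition ps_le (p q : ps_points) : Prop :=
  exists pq : tag p <= tag q, ps_map pq (tagged p) = tagged q.

Definition ps_times (C : set ps_points) : set R := [set tag p | p in C].

Definition chain_of (P C : set ps_points) : Prop :=
  C `<=` P /\ total_on C ps_le.

Definition maximal_chain_of (P C : set ps_points) : Prop :=
  chain_of P C /\ forall C', chain_of P C' -> C `<=` C' -> C' = C.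

Definition older (C1 C2 : set ps_points) : Prop :=
  exists2 t1, ps_times C1 t1 & forall t2, ps_times C2 t2 -> t1 < t2.

(* Several chains may a priori tie for oldest: no chain through y is older than C.
   Uniqueness is imposed separately, by [mt_oldest]. *)
Definition oldest_chain (P : set ps_points) (y : ps_points)
  (C : set ps_points) : Prop :=
  [/\ maximal_chain_of P C, C y &
      forall C', maximal_chain_of P C' -> C' y -> ~ older C' C].

End Chains.

Section Morse.
Variables (R : realType) (S : fin_pset R).

(* The restriction of S to [a, b[ is naturally isomorphic to the constant
   functor with value S a. *)
Definition constant_between (a b : R) : Prop :=
  exists g : forall t : R, t \in `[a, b[ -> S t -> S a,
    (forall (t : R) (It : t \in `[a, b[), bijective (g t It)) /\
    (forall (r t : R) (Ir : r \in `[a, b[) (It : t \in `[a, b[) (rt : r <= t)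
       (x : S r), g t It (ps_map rt x) = g r Ir x).

Definition ps_fiber (r t : R) (rt : r <= t) (x : S t) : {set S r} :=
  [set y | ps_map rt y == x]%SET.

Record morse_times (ts : seq R) : Prop := MorseTimes {
  mt_nonempty : (0 < size ts)%N;
  mt_sorted : sorted <%R ts;
  mt_before : forall t : R, t < head 0 ts -> #|S t| = 0%N;
  mt_constant : forall i : nat, (i.+1 < size ts)%N ->
    constant_between ts`_i ts`_i.+1;
  mt_after : forall t : R, last 0 ts <= t -> #|S t| = 1%N;
  mt_fibers : forall i : nat, (i.+1 < size ts)%N ->
    forall (h : ts`_i <= ts`_i.+1) (x : S ts`_i.+1), (#|ps_fiber h x| <= 2)%N;
  mt_oldest : forall y : ps_points S, exists! C, oldest_chain [set: _] y C
}.

Definition morse_set (ts : seq R) : Prop :=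
  morse_times ts /\
  forall ts' : seq R, morse_times ts' -> {subset ts' <= ts} -> ts' = ts.

(* The chains picked successively by the Elder Rule from what remains, P. *)
Inductive elder_steps (ts : seq R) :
  set (ps_points S) -> seq (set (ps_points S)) -> Prop :=
| elder_stop : elder_steps ts set0 [::]
| elder_step (P : set (ps_points S)) (y : ps_points S) C Cs :
    P y -> tag y \in ts ->
    (forall z, P z -> tag z \in ts -> tag z <= tag y) ->
    oldest_chain P y C -> elder_steps ts (P `\` C) Cs ->
    elder_steps ts P (C :: Cs).

Inductive elder_rule (ts : seq R) : seq (set (ps_points S)) -> Prop :=
| ElderRule (y : ps_points S) C Cs :
    tag y = last 0 ts -> oldest_chain [set: _] y C ->
    elder_steps ts ([set: _] `\` C) Cs -> elder_rule ts (C :: Cs).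

Definition elder_barcode (ts : seq R) (E : seq (interval R)) : Prop :=
  exists2 Cs, elder_rule ts Cs &
    [seq [set` J] | J <- E] = [seq ps_times C | C <- Cs].

End Morse.

(* Main.v *)
Require Import Defs.
From HB Require Import structures.
From mathcomp Require Import all_boot all_order all_algebra.
From mathcomp Require Import boolp classical_sets reals.

(** The new chain C met when the chains removed so far leave P runs from its
    minimum m until it merges into an earlier chain.  Since the earlier chains
    were the oldest available, some z outside P lives at the same time as m and
    is identified with m exactly when C dies.  Hence the translates of
    [m] - [z] generate a copy of the interval module of C inside F_S; for the
    chain that never dies take [m] alone.  Modulo the points outside P this
    generator is the basis vector of C, so the passage from the standard basis to these
    generators is unitriangular. *)

Set Implicit Arguments.
Unset Strict Implicit.
Unset Printing Implicit Defensive.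

Import Order.TTheory GRing.Theory Num.Theory.
Local Open Scope classical_set_scope.
Local Open Scope ring_scope.

(** * The poset of points and its maximal chains *)

Section PosetOfPoints.
Variables (R : realType) (S : fin_pset R).
Implicit Types (p q x y z : ps_points S) (P C : set (ps_points S)).

Definition ps_pt (t : R) (s : S t) : ps_points S := existT _ t s.

Lemma ps_le_refl p : ps_le p p.
Proof. by exists (lexx _); rewrite ps_map_id. Qed.

Lemma ps_le_tag p q : ps_le p q -> tag p <= tag q.
Proof. by case. Qed.

Lemma ps_le_trans q p r : ps_le p q -> ps_le q r -> ps_le p r.
Proof.
move=> [pq pqE] [qr qrE]; exists (le_trans pq qr).
by rewrite (ps_map_comp pq qr) pqE.
Qed.

Lemma ps_le_anti p q : ps_le p q -> tag q <= tag p -> p = q.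
Proof.
case: p q => [a x] [b y] [/= ab xy] ba.
have e : a = b by apply/le_anti/andP.
by subst b; rewrite -xy ps_map_id.
Qed.

Lemma ps_pt_inj (t : R) (s s' : S t) : ps_le (ps_pt s) (ps_pt s') -> s = s'.
Proof. by move=> [tt]; rewrite /= ps_map_id. Qed.

Lemma ps_le_up p q q' : ps_le p q -> ps_le p q' -> tag q <= tag q' -> ps_le q q'.
Proof.
move=> [pq pqE] [pq' pq'E] qq'; exists qq'.
by rewrite -pqE -(ps_map_comp pq qq' pq').
Qed.

Lemma ps_le_up_total p q q' :
  ps_le p q -> ps_le p q' -> ps_le q q' \/ ps_le q' q.
Proof.
move=> pq pq'; have [qq'|/ltW q'q] := leP (tag q) (tag q').
  by left; apply: (ps_le_up pq).
by right; apply: (ps_le_up pq').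
Qed.

Lemma ps_le_shift_le p q (t : R) (pt : tag p <= t) :
  ps_le p q -> t <= tag q -> ps_le (ps_pt (ps_map pt (tagged p))) q.
Proof. by move=> pq; apply: (@ps_le_up p (ps_pt _) q) => //; exists pt. Qed.

(* No point is born and no two points merge during [a, t]. *)
Definition steady (a t : R) : Prop :=
  forall (r s : R) (rs : r <= s), a <= r -> s <= t -> bijective (@ps_map R S r s rs).

Lemma steadyW a b t : a <= b -> steady a t -> steady b t.
Proof. by move=> ab st r s rs br st'; apply: st => //; apply: le_trans br. Qed.

(** Injectivity of the shift map from [tag q] to [tag x] forces the translate of [p] to be [q]: in
    the absence of mergers the past of [x] from time [a] on is a chain. *)
Lemma steady_le a p q x :
  steady a (tag x) -> a <= tag q -> ps_le p x -> ps_le q x -> tag p <= tag q ->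
  ps_le p q.
Proof.
move=> st aq [px pxE] [qx qxE] pq; exists pq.
apply: (bij_inj (st _ _ qx aq (lexx _))).
by rewrite -ps_map_comp qxE pxE.
Qed.

Lemma maximal_chain_add P C p :
  maximal_chain_of P C -> P p ->
  (forall q, C q -> ps_le q p \/ ps_le p q) -> C p.
Proof.
move=> [[CP Ctot] Cmax] Pp pC.
suff <- : C `|` [set p] = C by right.
apply: Cmax; last by left.
split=> [q [/CP//|->//]|x y [Cx|->] [Cy|->]]; first exact: Ctot.
- exact: pC.
- by have [|] := pC _ Cy; [right|left].
- by left; apply: ps_le_refl.
Qed.

(** Shift maps are functions, so the future of a point is a chain; hence a maximal chain of [P] can
    end only where its future leaves [P]. *)
Lemma maximal_chain_up P C p q :
  maximal_chain_of P C -> C p -> P q -> ps_le p q -> C q.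
Proof.
move=> Cm Cp Pq pq; apply: (maximal_chain_add Cm Pq) => r Cr.
have [rp|pr] := Cm.1.2 _ _ Cr Cp; first by left; apply: ps_le_trans pq.
exact: ps_le_up_total pr pq.
Qed.

Lemma maximal_chain_steady P C q x :
  maximal_chain_of P C -> C x -> P q -> ps_le q x -> steady (tag q) (tag x) -> C q.
Proof.
move=> Cm Cx Pq qx st; apply: (maximal_chain_add Cm Pq) => r Cr.
have [rx|xr] := Cm.1.2 _ _ Cr Cx; last by right; apply: ps_le_trans xr.
have [qr|/ltW rq] := leP (tag q) (tag r); first by right; exact: (steady_le st qr qx rx qr).
by left; exact: (steady_le st (lexx _) rx qx rq).
Qed.

Lemma chain_extends P C : chain_of P C -> exists2 C', maximal_chain_of P C' & C `<=` C'.
Proof.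
move=> Cch.
(* Zorn is applied to the sets whose union with [C] is a chain, so that the empty family satisfies
   the condition too. *)
have [F FF Ftot|A [[Ach CA] Amax]] :=
    @Zorn_bigcup _ [set D | chain_of P (C `|` D)].
  split=> [x|x y].
    by move=> [/Cch.1//|[D /FF[DP _] Dx]]; apply: DP; right.
  move=> [Cx|[D FD Dx]] [Cy|[D' FD' Dy]].
  - exact: Cch.2.
  - by apply: (FF _ FD').2; [left|right].
  - by apply: (FF _ FD).2; [right|left].
  - have [DD'|D'D] := Ftot _ _ FD FD'.
      by apply: (FF _ FD').2; right => //; apply: DD'.
    by apply: (FF _ FD).2; right => //; apply: D'D.
exists (C `|` A); last by left.
split=> // C' C'ch sub; apply/seteqP; split=> // x C'x.
apply: contrapT => nx.
have C'E : C `|` C' = C' by apply/setUidPr => y Cy; apply: sub; left.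
apply: (Amax C'); last by rewrite /= C'E.
split=> [y Ay|/(_ x C'x) Ax]; first by apply: sub; right.
by apply: nx; right.
Qed.

End PosetOfPoints.

(** * The invariant of the Elder Rule and the partner of a newborn chain *)

Section ElderInvariant.
Variables (R : realType) (S : fin_pset R) (ts : seq R).
Implicit Types (p q x y z : ps_points S) (P C : set (ps_points S)).

Lemma constant_between_steady (a b t : R) :
  constant_between S a b -> t < b -> steady S a t.
Proof.
move=> [g [gbij gnat]] tb r s rs ar st.
have Ir : r \in `[a, b[ by rewrite in_itv /= ar (le_lt_trans (le_trans rs st)).
have Is : s \in `[a, b[ by rewrite in_itv /= (le_trans ar rs) (le_lt_trans st).
have [h hK gK] := gbij s Is.
apply: (eq_bij (bij_comp (Bijective gK hK) (gbij r Ir))) => x /=.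
by rewrite -(gnat _ _ _ Is rs) hK.
Qed.

Lemma card1_bij (A B : finType) (f : A -> B) :
  #|A| = 1%N -> #|B| = 1%N -> bijective f.
Proof.
move=> A1 B1; apply: inj_card_bij; last by rewrite A1 B1.
by move=> x y _; apply: (fintype_le1P _) => //; rewrite A1.
Qed.

Hypothesis tsP : morse_times S ts.

(** The latest time of [ts] up to [tag x] serves: the shift maps from there on are bijective, so [x]
    can be traced back to it. *)
Lemma steady_start x :
  exists q, [/\ tag q \in ts, ps_le q x & steady S (tag q) (tag x)].
Proof.
suff [a [ats ax st]] : exists a, [/\ a \in ts, a <= tag x & steady S a (tag x)].
  have [h hK Kh] := st _ _ ax (lexx _) (lexx _).
  exists (ps_pt (h (tagged x))); split=> //=; exists ax; exact: Kh.
have [h0|/(mt_before tsP)/fintype0 //] := leP (head 0 ts) (tag x);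
  last by move=> /(_ (tagged x)).
have [le_last|lt_last] := leP (last 0 ts) (tag x).
  exists (last 0 ts); split=> //.
    by have := mt_nonempty tsP; case: (ts) => //= a s _; apply: mem_last.
  move=> r s rs lr _; apply: card1_bij; apply: (mt_after tsP) => //.
  exact: le_trans rs.
have ex : exists i, tag x < ts`_i.
  by exists (size ts).-1; rewrite nth_last.
(* The least index whose time is beyond [x] is not 0, since [x] does not precede the head; its
   predecessor [i] gives the latest time up to [x]. *)
have := ex_minnP ex => -[[|i] lti imin].
  by move: lti; rewrite nth0 ltNge h0.
have isz : (i.+1 < size ts)%N.
  apply: leq_ltn_trans (imin (size ts).-1 _) _; first by rewrite nth_last.
  by rewrite prednK // (mt_nonempty tsP).
exists ts`_i; split.
- by apply: mem_nth; apply: ltnW.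
- by rewrite leNgt; apply/negP => /imin; rewrite ltnn.
- exact: constant_between_steady (mt_constant tsP isz) lti.
Qed.

Lemma seq_min_time (Q : R -> Prop) (s : seq R) t :
  t \in s -> Q t ->
  exists a, [/\ a \in s, Q a & forall b, b \in s -> Q b -> a <= b].
Proof.
elim: s t => // a s IH t + Qt.
have [[u us Qu] _|no] := pselect (exists2 u, u \in s & Q u); last first.
  rewrite inE => /predU1P[ta|ts']; last by case: no; exists t.
  exists a; split; rewrite ?inE ?eqxx -?ta // => b.
  by rewrite inE => /predU1P[->//|bs Qb]; case: no; exists b.
have [b [bs Qb bmin]] := IH u us Qu.
have [[Qa ab]|nab] := pselect (Q a /\ a <= b).
  exists a; split=> // [|c]; first by rewrite inE eqxx.
  by rewrite inE => /predU1P[->//|cs Qc]; apply: le_trans (bmin _ cs Qc).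
exists b; split=> // [|c]; first by rewrite inE bs orbT.
rewrite inE => /predU1P[->Qa|]; last exact: bmin.
by have [//|/ltW ab] := leP b a; case: nab.
Qed.

(* The invariant of the Elder Rule satisfied by the points P that remain.  By
   [inv_elder], a point of P merges only into branches at least as old. *)
Record elder_inv P : Prop := ElderInv {
  inv_down : forall p q, P p -> ps_le q p -> P q;
  inv_steady : forall q x, P q -> ps_le q x -> steady S (tag q) (tag x) -> P x;
  inv_elder : forall y x, P y -> ~ P x -> ps_le y x ->
    exists z, [/\ tag z = tag y, ~ P z & ps_le z x]
}.

Lemma elder_inv_setT : elder_inv [set: _].
Proof. by split=> // y x _ /(_ Logic.I). Qed.

(** Only mergers into [C] are new. A point [y] that merges into [C] also lies below [y0], so if all
    of [C] were younger than [y], a chain through [y] and [y0] would be older than [C]. *)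
Lemma elder_inv_setD P y0 C :
  elder_inv P -> (forall z, P z -> tag z \in ts -> tag z <= tag y0) ->
  oldest_chain P y0 C -> elder_inv (P `\` C).
Proof.
move=> [Pdown Psteady Pelder] y0max [Cm Cy0 Cold].
have CP := Cm.1.1.
split=> [p q [Pp nCp] qp|q x [Pq nCq] qx st|y x [Py nCy] nPCx yx].
- split; first exact: Pdown qp.
  by move=> Cq; apply: nCp; apply: (maximal_chain_up Cm Cq).
- split; first exact: Psteady qx st.
  by move=> Cx; apply: nCq; apply: (maximal_chain_steady Cm Cx).
have [Px|nPx] := pselect (P x); last first.
  have [z [zy nPz zx]] := Pelder _ _ Py nPx yx.
  by exists z; split=> // -[].
have Cx : C x by apply: contrapT => nCx; apply: nPCx.
(* If [y0] lies below [x], the choice of [y0] over the latest time excludes mergers between [y0] and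
   [x]. Then [y] and [y0] are comparable, and [y] above [y0] would belong to [C]. *)
have yy0 : ps_le y y0.
  have [xy0|y0x] := Cm.1.2 _ _ Cx Cy0; first exact: ps_le_trans xy0.
  have [q [qts qx st]] := steady_start x.
  have qy0 := y0max q (Pdown _ _ Px qx) qts.
  have [yley0|/ltW y0ley] := leP (tag y) (tag y0).
    exact: (steady_le st qy0 yx y0x yley0).
  case: nCy; apply: (maximal_chain_up Cm Cy0) => //.
  exact: (steady_le st (le_trans qy0 y0ley) y0x yx y0ley).
(* An oldest chain C cannot start after y, since y and the points above it lie on a
   chain through y0; so some z in C is no younger than y. *)
have [C' C'm sub] : exists2 C', maximal_chain_of P C' & [set z | P z /\ ps_le y z] `<=` C'.
  by apply: chain_extends; split=> [z []//|z z' [_ yz] [_ yz']]; apply: ps_le_up_total yz yz'.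
have [z Cz zy] : exists2 z, C z & tag z <= tag y.
  apply: contrapT => noz; apply: (Cold C' C'm); first by apply: sub; split=> //; apply: CP.
  exists (tag y); first by exists y => //; apply: sub; split=> //; apply: ps_le_refl.
  by move=> _ [z Cz <-]; rewrite ltNge; apply/negP => zy; apply: noz; exists z.
have zx : ps_le z x.
  have [//|xz] := Cm.1.2 _ _ Cz Cx.
  rewrite -(ps_le_anti xz) ?(le_trans zy (ps_le_tag yx)) //; exact: ps_le_refl.
(* The witness is [z] moved up to the time of [y]; being below [x] it is in [P], hence still on
   [C]. *)
have z'x := ps_le_shift_le zy zx (ps_le_tag yx).
exists (ps_pt (ps_map zy (tagged z))); split=> // -[_]; apply.
by apply: (maximal_chain_up Cm Cz); [apply: Pdown z'x|exists zy].
Qed.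

(** Every point of [C] lies above a point of [C] over some time of [ts], and [ts] is finite. *)
Lemma maximal_chain_min P C y :
  elder_inv P -> maximal_chain_of P C -> C y ->
  exists2 m, C m & forall z, C z -> ps_le m z.
Proof.
move=> Pinv Cm Cy.
have start x : C x -> exists q, [/\ C q, tag q \in ts & ps_le q x].
  move=> Cx; have [q [qts qx st]] := steady_start x.
  exists q; split=> //; apply: (maximal_chain_steady Cm Cx) => //.
  by apply: inv_down qx => //; apply: Cm.1.1.
have [q [Cq qts _]] := start _ Cy.
have [a [_ [m Cmm <-] mmin]] := @seq_min_time (ps_times C) ts _ qts (ex_intro2 _ _ q Cq erefl).
exists m => // z Cz; have [r [Cr rts rz]] := start _ Cz.
have [//|zm] := Cm.1.2 _ _ Cmm Cz.
rewrite (ps_le_anti zm) ?(le_trans (mmin _ rts _) (ps_le_tag rz)) //; last by exists r.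
exact: ps_le_refl.
Qed.

(** If the future of [m] leaves [P], [inv_elder] is applied at the first time of [ts] where it is
    outside; every later exit point lies above that one, so a single [z] serves for all [x]. *)
Lemma elder_partner P m :
  elder_inv P -> P m ->
  (forall x, ps_le m x -> P x) \/
  exists z : S (tag m), ~ P (ps_pt z) /\
    forall x, ps_le m x -> ~ P x -> ps_le (ps_pt z) x.
Proof.
move=> Pinv Pm.
have [allP|/existsNP[x0 /not_implyP[mx0 nPx0]]] := pselect (forall x, ps_le m x -> P x).
  by left.
right.
have start x : ps_le m x -> ~ P x ->
    exists q, [/\ tag q \in ts, ps_le m q, ps_le q x & ~ P q].
  move=> mx nPx; have [q [qts qx st]] := steady_start x.
  exists q; split=> //; last by move=> Pq; apply: nPx; apply: inv_steady qx st.
  have [mq|/ltW qm] := leP (tag m) (tag q); first exact: (steady_le st (lexx _) mx qx mq).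
  by case: nPx; apply: (inv_steady Pinv Pm) => //; apply: steadyW st.
have [q0 [q0ts mq0 _ nPq0]] := start _ mx0 nPx0.
have [a [ats [q [<- mq nPq]] qmin]] := @seq_min_time
  (fun t => exists q, [/\ tag q = t, ps_le m q & ~ P q]) ts _ q0ts
  (ex_intro _ q0 (And3 erefl mq0 nPq0)).
have [[b z] [/= bm nPz zq]] := inv_elder Pinv Pm nPq mq.
subst b; exists z; split=> // x mx nPx.
have [r [rts mr rx nPr]] := start _ mx nPx.
apply: ps_le_trans zq _; apply: ps_le_trans rx.
by apply: (ps_le_up mq mr); apply: qmin => //; exists r.
Qed.
End ElderInvariant.

(** * Morphisms out of interval modules and direct sums *)

Section PVectMorphisms.
Variables (R : realType) (K : fieldType).
Implicit Types V W : pvect R K.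

Definition pvect_natural V W (f : forall t, {linear V t -> W t}) : Prop :=
  forall (r t : R) (rt : r <= t) (v : V r),
    f t (pv_map V rt v) = pv_map W rt (f r v).

Lemma pvect_iso_inverse V W (g : forall t, {linear W t -> V t}) :
  pvect_natural g -> (forall t, bijective (g t)) -> pvect_iso V W.
Proof.
move=> gnat gbij.
have inv t : {f : {linear V t -> W t} | cancel (g t) f /\ cancel f (g t)}.
  apply/cid; have [h gK hK] := gbij t.
  pose hL := GRing.isLinear.Build K (V t) (W t) *:%R h (can2_linear gK hK).
  by exists (HB.pack_for {linear V t -> W t} h hL).
exists (fun t => sval (inv t)); split=> [t|r t rt v].
  by have [gK fK] := svalP (inv t); exists (g t).
have [gKt _] := svalP (inv t); have [_ fKr] := svalP (inv r).
by rewrite -{1}[v]fKr -gnat gKt.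
Qed.

(** For [n] a boolean this reads off the only coordinate, or gives 0 on the zero space, without
    casts between the two cases. *)
Definition row_sum n (w : 'rV[K]_n) : K := \sum_j w ord0 j.

Lemma row_sum_is_linear n : scalar (@row_sum n).
Proof.
move=> c u v; rewrite /row_sum mulr_sumr -big_split /=.
by apply: eq_bigr => j _; rewrite !mxE.
Qed.

Lemma row_sum_eq0 (b : bool) (w : 'rV[K]_b) : row_sum w = 0 -> w = 0.
Proof.
case: b w => w; last by rewrite thinmx0.
by rewrite /row_sum big_ord1 => w0; apply/rowP => j; rewrite ord1 w0 mxE.
Qed.

Lemma row_sum_const (b : bool) (c : K) : row_sum (const_mx c : 'rV_b) = if b then c else 0.
Proof. by rewrite /row_sum; case: b; rewrite ?big_ord0 // big_ord1 mxE. Qed.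

Lemma row_sum_false (b : bool) (w : 'rV[K]_b) : ~~ b -> row_sum w = 0.
Proof. by case: b w => // w _; rewrite /row_sum big_ord0. Qed.

Lemma row_sum_itv_map (J : interval R) (r t : R) (w : 'rV[K]_(r \in J)) :
  t \in J -> row_sum (itv_map K J r t w) = row_sum w.
Proof.
rewrite /row_sum /itv_map /=; case: (t \in J) => // _.
by rewrite big_ord1 mxE; apply: eq_bigr => j _; rewrite mxE mulr1.
Qed.

Section ItvMorphism.
Variables (V : pvect R K) (J : interval R) (a : R) (v0 : V a).

(** The value 0 before time [a] is a filler: when [J] starts no earlier than [a], it only meets zero
    coefficients. *)
Definition pv_gen (t : R) : V t :=
  if pselect (a <= t) is left h then pv_map V h v0 else 0.

Lemma pv_genE (t : R) (h : a <= t) : pv_gen t = pv_map V h v0.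
Proof. by rewrite /pv_gen; case: pselect => // h'; rewrite (Prop_irrelevance h' h). Qed.

Definition itv_mor (t : R) (w : 'rV[K]_(t \in J)) : V t := row_sum w *: pv_gen t.

Lemma itv_mor_is_linear t : linear (@itv_mor t).
Proof. by move=> c u v; rewrite /itv_mor row_sum_is_linear scalerDl scalerA. Qed.

HB.instance Definition _ t :=
  GRing.isLinear.Build K 'rV[K]_(t \in J) (V t) *:%R (@itv_mor t) (@itv_mor_is_linear t).

(** Before [J] the source is 0, within [J] both sides are translates of [v0], and after [J] the
    vector [v0] has died. *)
Lemma itv_mor_natural :
  (forall t, t \in J -> a <= t) ->
  (forall t (h : a <= t), t \notin J -> pv_map V h v0 = 0) ->
  pvect_natural (V := itv_pvect K J) (fun t => @itv_mor t).
Proof.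
move=> Ja v0J r t rt w; rewrite /= /itv_mor linearZ /=.
have [rJ|rJ] := orP (orbN (r \in J)); last first.
  rewrite (row_sum_false w) // scale0r.
  have -> : w = 0 :> 'rV_(r \in J) by apply: row_sum_eq0; rewrite row_sum_false.
  by rewrite mul0mx /row_sum big1 ?scale0r // => j _; rewrite mxE.
have ar := Ja r rJ; have at' := le_trans ar rt.
rewrite (pv_genE ar) (pv_genE at') -pv_map_comp.
have [tJ|tJ] := orP (orbN (t \in J)); first by rewrite row_sum_itv_map.
by rewrite v0J // !scaler0.
Qed.

End ItvMorphism.

Section SumMorphism.
Variables (V W U : pvect R K).
Variables (f : forall t, {linear V t -> U t}) (g : forall t, {linear W t -> U t}).

Definition sum_mor t (p : V t * W t) : U t := f t p.1 + g t p.2.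

Lemma sum_mor_is_linear t : linear (@sum_mor t).
Proof. by move=> c p q; rewrite /sum_mor !linearP scalerDr addrACA. Qed.

HB.instance Definition _ t :=
  GRing.isLinear.Build K (V t * W t)%type (U t) *:%R (@sum_mor t) (@sum_mor_is_linear t).

Lemma sum_mor_natural : pvect_natural f -> pvect_natural g ->
  pvect_natural (V := sum_pvect V W) (fun t => @sum_mor t).
Proof. by move=> fn gn r t rt p; rewrite /= /sum_mor /= fn gn linearD. Qed.

End SumMorphism.
End PVectMorphisms.

(** * Induction along the Elder Rule *)

Section FreeOnElderChains.
Variables (R : realType) (K : fieldType) (S : fin_pset R) (ts : seq R).
Hypothesis tsP : morse_times S ts.
Implicit Types (P C : set (ps_points S)).

Local Notation F := (free_pvect K S).

Lemma free_pv_map_basis (r t : R) (rt : r <= t) (s : S r) :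
  pv_map F rt (free_basis K s) = free_basis K (ps_map rt s).
Proof. exact: free_map_basis. Qed.

(** Entries outside [P] are left unspecified, since the generator may have the entry -1 of its
    partner there. *)
Lemma chain_morphism P C y (J : interval R) :
  elder_inv P -> maximal_chain_of P C -> C y -> [set` J] = ps_times C ->
  exists h : forall t, {linear itv_pvect K J t -> F t}, pvect_natural h /\
    forall t, t \in J -> exists c : S t, C (ps_pt c) /\
      forall (w : 'rV[K]_(t \in J)) (s : S t), P (ps_pt s) ->
        (h t w : {ffun S t -> K^o}) s = row_sum w * (s == c)%:R.
Proof.
move=> Pinv Cm Cy JE; have CP := Cm.1.1.
have [m mC mmin] := maximal_chain_min tsP Pinv Cm Cy.
have Jt t : t \in J -> exists2 c, C c & tag c = t.
  by move=> tJ; have : [set` J] t by []; rewrite JE.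
have tJ c : C c -> tag c \in J.
  by move=> Cc; suff : [set` J] (tag c) by []; rewrite JE; exists c.
have Jm t : t \in J -> tag m <= t by move=> /Jt[c Cc <-]; apply/ps_le_tag/mmin.
have JC t (mt : tag m <= t) : t \in J -> C (ps_pt (ps_map mt (tagged m))).
  move=> /Jt[[t' c] Cc /= tE]; subst t'.
  suff -> : ps_map mt (tagged m) = c by [].
  by have [/= mt' <-] := mmin _ Cc; congr ps_map; apply: Prop_irrelevance.
have nJP t (mt : tag m <= t) : t \notin J -> ~ P (ps_pt (ps_map mt (tagged m))).
  move=> /negP nJ Pmt; apply: nJ; apply: (tJ (ps_pt (ps_map mt (tagged m)))).
  by apply: (maximal_chain_up Cm mC Pmt); exists mt.
have [v0 [v0J v0nJ]] : exists v0 : F (tag m),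
    (forall t (mt : tag m <= t) (s : S t), t \in J -> P (ps_pt s) ->
      (pv_map F mt v0 : {ffun S t -> K^o}) s = (s == ps_map mt (tagged m))%:R) /\
    (forall t (mt : tag m <= t), t \notin J -> pv_map F mt v0 = 0).
  have [allP|[z [nPz zle]]] := elder_partner tsP Pinv (CP _ mC).
    exists (free_basis K (tagged m)); split=> t mt => [s tJ' Ps|/(nJP _ mt)].
      by rewrite free_pv_map_basis ffunE.
    by case; apply: allP; exists mt.
  (* The translates of [z] never re-enter [P], so they do not disturb the entries on [P]; once [m]
     has left [P] the two translates coincide and cancel. *)
  exists (free_basis K (tagged m) - free_basis K z).
  split=> t mt => [s tJ' Ps|nJ]; rewrite linearB /= !free_map_basis.
    rewrite !ffunE; case: (s =P ps_map mt z) => [sz|_]; last by rewrite subr0.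
    by case: nPz; apply: (inv_down Pinv Ps); rewrite sz; exists mt.
  have : ps_le (ps_pt z) (ps_pt (ps_map mt (tagged m))).
    by apply: zle; [exists mt|apply: nJP].
  case=> mt' /= <-; rewrite (Prop_irrelevance mt' mt) subrr //.
exists (fun t => @itv_mor R K F J _ v0 t); split; first exact: itv_mor_natural.
move=> t tJ'; have mt := Jm t tJ'.
exists (ps_map mt (tagged m)); split; first exact: JC.
by move=> w s Ps; rewrite /= /itv_mor ffunE (pv_genE _ mt) v0J.
Qed.

(** For linear [g], this says that [g] followed by the projection onto the coordinates in [P] is
    bijective; for the full set it is bijectivity of [g]. *)
Definition bijective_on P (t : R) (U : lmodType K) (g : U -> {ffun S t -> K^o}) : Prop :=
  (forall v : S t -> K, exists u, forall s, P (ps_pt s) -> g u s = v s) /\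
  (forall u, (forall s, P (ps_pt s) -> g u s = 0) -> u = 0).

(** On [P] the new summand hits only the point of [C], while the remaining ones are bijective onto
    the coordinates of [P] minus [C]: the sum is block triangular. *)
Lemma elder_steps_morphism P Cs (E : seq (interval R)) :
  elder_steps ts P Cs -> elder_inv P ->
  [seq [set` J] | J <- E] = [seq ps_times C | C <- Cs] ->
  exists g : forall t, {linear barcode_pvect K E t -> F t},
    pvect_natural g /\ forall t, bijective_on P (g t).
Proof.
move=> PCs; elim: PCs E => {P Cs} [|P y C Cs Py yts ymax Cold _ IH] [|J E] //= Pinv.
  move=> _; exists (fun t => \0 : {linear zero_pvect R K t -> F t}); split.
    by move=> r t rt v /=; rewrite linear0.
  by move=> t; split=> [v|u _]; [exists 0|rewrite [u]thinmx0].
move=> [JE EE]; have [g [gnat gbij]] := IH E (elder_inv_setD tsP Pinv ymax Cold) EE.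
have [Cm Cy _] := Cold.
have [h [hnat hE]] := chain_morphism Pinv Cm Cy JE.
pose f t : {linear sum_pvect (itv_pvect K J) (barcode_pvect K E) t -> F t} :=
  @sum_mor R K (itv_pvect K J) (barcode_pvect K E) F h g t.
exists f; split=> [|t]; first exact: sum_mor_natural.
have fE w u s : (f t (w, u) : {ffun S t -> K^o}) s =
    (h t w : {ffun S t -> K^o}) s + (g t u : {ffun S t -> K^o}) s by apply: ffunE.
have g0 s : (g t 0 : {ffun S t -> K^o}) s = 0 by rewrite linear0 ffunE.
have h0 s : (h t 0 : {ffun S t -> K^o}) s = 0 by rewrite linear0 ffunE.
have [gsurj ginj] := gbij t.
have [tJ|tJ] := orP (orbN (t \in J)).
  have [c [Cc hc]] := hE t tJ.
  have Pc := Cm.1.1 _ Cc.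
  have PnC s : P (ps_pt s) -> s != c -> (P `\` C) (ps_pt s).
    move=> Ps /eqP sc; split=> // Cs'; apply: sc.
    by have [/ps_pt_inj|/ps_pt_inj] := Cm.1.2 _ _ Cs' Cc.
  have hnC w s : (P `\` C) (ps_pt s) -> (h t w : {ffun S t -> K^o}) s = 0.
    move=> [Ps nCs]; rewrite hc //; case: eqP => [sc|]; last by rewrite mulr0.
    by case: nCs; rewrite sc.
  split=> [v|[w u] wu0].
    have [u uE] := gsurj v.
    (* Nothing is known of [g t u] at [c], so the coefficient of the new generator absorbs that
       entry. *)
    exists (const_mx (v c - (g t u : {ffun S t -> K^o}) c), u) => s Ps.
    rewrite fE; have [->|sc] := eqVneq s c.
      by rewrite hc // row_sum_const tJ eqxx mulr1 subrK.
    by rewrite hnC ?add0r ?uE //; apply: PnC.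
  have u0 : u = 0.
    by apply: ginj => s Ps; have := wu0 s Ps.1; rewrite fE hnC // add0r.
  have := wu0 c Pc; rewrite u0 fE g0 addr0 hc // eqxx mulr1.
  by move=> /row_sum_eq0 ->.
(* Outside [J] the new summand is zero and [C] has no point, so removing [C] changes nothing at time
   [t]. *)
have w0 (w : 'rV[K]_(t \in J)) : w = 0.
  by apply: row_sum_eq0; apply: row_sum_false.
have PnC (s : S t) : P (ps_pt s) -> (P `\` C) (ps_pt s).
  move=> Ps; split=> // Cs'; apply/negP: tJ; apply/negPn.
  by suff : [set` J] t by []; rewrite JE; exists (ps_pt s).
split=> [v|[w u] wu0].
  have [u uE] := gsurj v; exists (0, u) => s Ps.
  by rewrite fE h0 add0r uE //; apply: PnC.
have -> : u = 0.
  apply: ginj => s [Ps _]; have := wu0 s Ps.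
  by rewrite fE [w]w0 h0 add0r.
by rewrite [w]w0.
Qed.

End FreeOnElderChains.

(** The initial choice is an ordinary step, because the last entry of the sorted list [ts] is its
    greatest. *)
Lemma elder_rule_steps (R : realType) (S : fin_pset R) (ts : seq R) Cs :
  morse_times S ts -> elder_rule ts Cs -> elder_steps (S := S) ts [set: _] Cs.
Proof.
move=> tsP [y C {}Cs yE Cold steps].
apply: (elder_step (y := y)) => //.
  by have := mt_nonempty tsP; rewrite yE; case: (ts) => //= a s _; apply: mem_last.
move=> z _ zts; rewrite yE -nth_last -(nth_index 0 zts).
have zi : (index (tag z) ts < size ts)%N by rewrite index_mem.
have ts_gt0 := mt_nonempty tsP.
have le_sorted : sorted <=%R ts by apply: sub_sorted (mt_sorted tsP) => a b /ltW.
apply: (sorted_leq_nth le_trans lexx) => //; first by rewrite inE prednK.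
by rewrite -ltnS prednK.
Qed.

Theorem theorem3p10 (R : realType) (K : fieldType) (S : fin_pset R)
  (ts : seq R) (S_morse : morse_set S ts)
  (E : seq (interval R)) (E_elder : elder_barcode S ts E) :
  pvect_iso (free_pvect K S) (barcode_pvect K E).
Proof.
have tsP := S_morse.1; have [Cs rule EE] := E_elder.
have [g [gnat gbij]] :=
  elder_steps_morphism K tsP (elder_rule_steps tsP rule) (elder_inv_setT _) EE.
apply: (pvect_iso_inverse gnat) => t; have [gsurj ginj] := gbij t.
have surj v : exists u, g t u = v.
  by have [u uE] := gsurj v; exists u; apply/ffunP => s; apply: uE.
have inv v : {u | g t u = v} := cid (surj v).
exists (fun v => sval (inv v)) => [u|v]; last exact: svalP (inv v).
apply/eqP; rewrite -subr_eq0; apply/eqP/ginj => s _.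
by rewrite linearB /= (svalP (inv _)) subrr ffunE.
Qed.
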